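(* Let $n=2$, $1<p\le2$, $f\equiv0$ and $R>0$. Assume that $g\in C^1(\mathbf{R}^2)$ is non-negative, does not vanish identically, and has compact support with $\mathrm{supp}\,g\subset\{x\in\mathbf{R}^2:|x|\le R\}$. For $\varepsilon>0$, suppose that the integral equation $$u(x,t)=\frac{\varepsilon}{2\pi}\int_{|x-y|\le t}\frac{g(y)}{\sqrt{t^2-|x-y|^2}}\,dy+\frac{1}{2\pi}\int_0^t d\tau\int_{|x-y|\le t-\tau}\frac{|u(y,\tau)|^p}{\sqrt{(t-\tau)^2-|x-y|^2}}\,dy$$ (associated with the problem $u_{tt}-\Delta u=|u|^p$ in $\mathbf{R}^2\times[0,\infty)$, $u(x,0)=0$, $u_t(x,0)=\varepsilon g(x)$) has a solution $u\in C^1(\mathbf{R}^2\times[0,T(\varepsilon)))$ with $\mathrm{supp}\,u\subset\{(x,t)\in\mathbf{R}^2\times[0,\infty):|x|\le t+R\}$, where $T(\varepsilon)$ is the lifespan. Then there exist a positive constant $\varepsilon_2=\varepsilon_2(g,p,R)$ and a positive constant $C$ independent of $\varepsilon$ such that, for all $0<\varepsilon\le\varepsilon_2$, $$T(\varepsilon)\le\begin{cases}C\,a(\varepsilon)&\text{when }p=2,\\ C\,\varepsilon^{-(p-1)/(3-p)}&\text{when }1<p<2,\end{cases}$$ where $a=a(\varepsilon)>0$ is the number satisfying $a^2\varepsilon^2\log(1+a)=1$.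
   Context: Lifespan: for fixed data, $T(\varepsilon)\in(0,\infty]$ is the supremum of all $t>0$ such that a solution $u(x,t)$ (here: of the integral equation) exists up to time $t$. *)

(* Defs.v *)
From HB Require Import structures.
From mathcomp Require Import all_boot all_order all_algebra.
From mathcomp Require Import all_classical all_reals all_analysis.

Set Implicit Arguments.
Unset Strict Implicit.
Unset Printing Implicit Defensive.

Import Order.TTheory GRing.Theory Num.Theory.
Import numFieldNormedType.Exports.

Local Open Scope classical_set_scope.
Local Open Scope ring_scope.

(* The library norm on R * R is the sup norm. *)
Definition euclid {R : realType} (x : R * R) : R :=
  Num.sqrt (x.1 ^+ 2 + x.2 ^+ 2).

Definition disc {R : realType} (x : R * R) (r : R) : set (R * R) :=
  [set y | euclid (x - y) <= r].

(* C^1 on a set D contained in the closure of its interior: f is C^1 in the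
   interior, and f and its first derivatives extend continuously to D. *)
Definition C1_on {R : realType} {V : normedModType R} (D : set V)
    (f : V -> R) : Prop :=
  [/\ {within D, continuous f},
      forall z, D° z -> differentiable f z
    & forall v, exists2 w : V -> R, {within D, continuous w} &
        forall z, D° z -> 'D_v f z = w z].

Definition supp {R : realType} {V : normedModType R} (D : set V)
    (f : V -> R) : set V :=
  closure (D `&` [set z | f z != 0]).

(* Space-time points are written (x, t) : R * R * R. *)
Definition slab {R : realType} (T : \bar R) : set (R * R * R) :=
  [set z | 0 <= z.2 /\ (z.2%:E < T)%E].

Definition leb2 {R : realType} := (@lebesgue_measure R \x @lebesgue_measure R)%E.

(* At the boundary of the disc, which is a null set, the kernel 1 / sqrt 0
   takes the conventional value 0. *)
Definition wave_kernel {R : realType} (s : R) (x y : R * R) : R :=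
  (Num.sqrt (s ^+ 2 - euclid (x - y) ^+ 2))^-1.

(* All integrands are nonnegative when g is, so the integrals are taken in
   \bar R; the equation then forces them to be finite. *)
Definition integral_eq {R : realType} (g : R * R -> R) (p eps : R)
    (T : \bar R) (u : R * R * R -> R) : Prop :=
  forall (x : R * R) (t : R), slab T (x, t) ->
  ((u (x, t))%:E =
   (eps / (2 * pi))%:E *
     (\int[leb2]_(y in disc x t) (g y * wave_kernel t x y)%:E) +
   (2 * pi)^-1%:E *
     (\int[lebesgue_measure]_(tau in `[0%R, t])
        \int[leb2]_(y in disc x (t - tau))
          (`|u (y, tau)| `^ p * wave_kernel (t - tau) x y)%:E))%E.

Definition C1_solution {R : realType} (g : R * R -> R) (p eps : R)
    (T : \bar R) (u : R * R * R -> R) : Prop :=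
  C1_on (slab T) u /\ integral_eq g p eps T u.

(* The supremum of the empty set is -oo in \bar R. *)
Definition lifespan {R : realType} (g : R * R -> R) (p eps : R) : \bar R :=
  ereal_sup [set t%:E | t in
    [set t : R | 0 < t /\ exists u, C1_solution g p eps t%:E u]].

Definition is_a {R : realType} (eps a : R) : Prop :=
  0 < a /\ a ^+ 2 * eps ^+ 2 * ln (1 + a) = 1.

(* Well defined for 0 < eps, by is_a_unique and a_ofP below. *)
Definition a_of {R : realType} (eps : R) : R := get [set a | is_a eps a].

Lemma is_a_unique (R : realType) (eps a b : R) :
  0 < eps -> is_a eps a -> is_a eps b -> a = b.
Proof.
move=> e0.
have lt_ne c d : is_a eps c -> is_a eps d -> ~ c < d.
  move=> [c0 hc] [d0 hd] cd.
  suff : (1 : R) < 1 by rewrite ltxx.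
  rewrite -{1}hc -[ltRHS]hd; apply: ltr_pM.
  - by rewrite mulr_ge0 ?sqr_ge0.
  - by apply: ln_ge0; rewrite lerDl ltW.
  - by rewrite ltr_pM2r ?exprn_gt0 // ltrXn2r // ltW.
  - by rewrite ltr_ln ?posrE ?addr_gt0 // ltrD2l.
by move=> ha hb; case: (ltgtP a b) => // h; [case: (lt_ne a b)|case: (lt_ne b a)].
Qed.

Lemma a_ofP (R : realType) (eps : R) : 0 < eps -> is_a eps (a_of eps).
Proof.
move=> e0; rewrite /a_of; apply: (@getPex _ [set a | is_a eps a]).
pose h (a : R) := a ^+ 2 * eps ^+ 2 * ln (1 + a).
pose M : R := expR 1 + eps^-1.
have M0 : 0 < M by rewrite addr_gt0 ?expR_gt0 ?invr_gt0.
have h0 : h 0 = 0 by rewrite /h expr0n/= !mul0r.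
have hM : 1 <= h M.
  have Me1 : 1 <= M * eps.
    by rewrite mulrDl mulVf ?gt_eqF // ler_wpDl // mulr_ge0 ?expR_ge0 ?ltW.
  rewrite /h -exprMn -[leLHS]mul1r ler_pM //; first exact: exprn_ege1.
  rewrite -{1}(@expRK R 1) ler_ln ?posrE ?expR_gt0 ?addr_gt0 ?invr_gt0 //.
  by rewrite /M addrCA ler_wpDr // addr_ge0 // invr_ge0 ltW.
have ch : {within `[0, M], continuous h}.
  apply/continuous_in_subspaceT => x; rewrite inE/= in_itv/= => /andP[x0 _].
  apply: cvgM; first by apply: cvgMl; exact: exprn_continuous.
  apply: continuous_comp; first by apply: cvgD; [exact: cvg_cst|exact: cvg_id].
  by apply: continuous_ln; rewrite ltr_pwDl.
have h1 : Num.min (h 0) (h M) <= 1 <= Num.max (h 0) (h M).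
  by rewrite h0 ge_min le_max ler01 hM orbT.
have [a] := IVT (ltW M0) ch h1.
rewrite in_itv/= => /andP[a0 _] ha; exists a; split => //.
rewrite lt_neqAle a0 andbT; apply/eqP => a00.
by move: ha; rewrite -a00 h0 => /eqP; rewrite eq_sym oner_eq0.
Qed.

(* Main.v *)
(* The integral equation yields pointwise lower bounds for u in the cone
   |x| <= t / 2.  The datum gives u >= c eps / sqrt (t (t - |x|)).  If
   u >= m on the cone for times in [t - h, t), the nonlinear term gives
   u (x, t) >= c h^2 m^p, because a fixed fraction of each backward ball of
   (x, t) lies in the cone.  Iterating this over [S, 2 S] with steps S / 2^k
   forces u = +oo at (0, 2 S) as soon as S^2 m^(p-1) is large.  For p < 2 one
   starts from m = c eps / S; for p = 2 feeding the linear bound once into the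
   nonlinear term, where the singularity near the light cone yields a logarithm,
   improves this to m = c eps^2 log S. *)
Require Import Defs.
From HB Require Import structures.
From mathcomp Require Import all_boot all_order all_algebra.
From mathcomp Require Import all_classical all_reals all_analysis.
From mathcomp Require Import measurable_realfun.
From mathcomp Require Import ring lra.

Set Implicit Arguments.
Unset Strict Implicit.
Unset Printing Implicit Defensive.

Import Order.TTheory GRing.Theory Num.Theory.
Import numFieldNormedType.Exports.

Local Open Scope classical_set_scope.
Local Open Scope ring_scope.

(** * Lower bounds for integrals of nonnegative functions *)

(** Such an integral is a supremum over the simple functions below the extension by zero, so
    comparing the two extensions pointwise is enough, whether or not [f] and [h] are measurable. *)
Lemma le_integral_subset d (T : measurableType d) (R : realType)
    (mu : {measure set T -> \bar R}) (A D : set T) (f h : T -> \bar R) :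
  A `<=` D -> (forall x, A x -> 0 <= f x)%E -> (forall x, D x -> 0 <= h x)%E ->
  (forall x, A x -> f x <= h x)%E ->
  (\int[mu]_(x in A) f x <= \int[mu]_(x in D) h x)%E.
Proof.
move=> AD f0 h0 fh; rewrite !ge0_integralE //.
apply: le_ereal_sup => _ [s sf <-]; exists s => // x.
apply: le_trans (sf x) _; rewrite !patchE.
case: ifPn => xA; first by rewrite mem_set ?fh //; [exact: set_mem|apply: AD; exact: set_mem].
by case: ifPn => // xD; apply: h0; exact: set_mem.
Qed.

Lemma integral_ge_cst d (T : measurableType d) (R : realType)
    (mu : {measure set T -> \bar R}) (A D : set T) (f : T -> \bar R) (c m : R) :
  measurable A -> A `<=` D -> (forall x, D x -> 0 <= f x)%E -> 0 <= c ->
  (forall x, A x -> c%:E <= f x)%E -> (m%:E <= mu A)%E ->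
  ((c * m)%:E <= \int[mu]_(x in D) f x)%E.
Proof.
move=> mA AD f0 c0 cf mm.
have c0' x : A x -> (0 <= cst c%:E x)%E by rewrite lee_fin.
apply: le_trans (le_integral_subset mu AD c0' f0 cf).
by rewrite integral_cst // EFinM lee_wpmul2l // lee_fin.
Qed.

Lemma lebesgue_itvcc (R : realType) (a b : R) :
  a <= b -> lebesgue_measure `[a, b]%classic = (b - a)%:E.
Proof.
move=> ab; rewrite lebesgue_measure_itv /= lte_fin; case: ltP => // ba.
by have -> : a = b; [apply/le_anti; rewrite ab|rewrite subrr].
Qed.

(** A closed ball of the sup norm: its product measure is explicit, so boxes inside discs replace
    the computation of Euclidean areas. *)
Definition box (R : realType) (z : R * R) (r : R) : set (R * R) :=
  `[z.1 - r, z.1 + r] `*` `[z.2 - r, z.2 + r].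

Lemma leb2_box (R : realType) (z : R * R) (r : R) :
  0 <= r -> @leb2 R (box z r) = (4 * r ^+ 2)%:E.
Proof.
move=> r0; rewrite /leb2 /box product_measure1E //.
transitivity ((2 * r)%:E * (2 * r)%:E)%E; last first.
  by rewrite -EFinM; congr EFin; ring.
congr (_ * _)%E; (apply: etrans (lebesgue_itvcc _) _; first lra).
  by congr EFin; ring.
by congr EFin; ring.
Qed.

Lemma leb2_integral_ge_cst (R : realType) (z : R * R) (r c : R)
    (D : set (R * R)) (f : R * R -> R) :
  0 <= r -> 0 <= c -> box z r `<=` D -> (forall y, D y -> 0 <= f y) ->
  (forall y, box z r y -> c <= f y) ->
  ((c * (4 * r ^+ 2))%:E <= \int[leb2]_(y in D) (f y)%:E)%E.
Proof.
move=> r0 c0 zD f0 cf.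
apply: (@integral_ge_cst _ _ _ (lebesgue_measure \x lebesgue_measure)%E (box z r)).
- by apply: measurableX; exact: measurable_itv.
- by [].
- by move=> y /f0; rewrite lee_fin.
- by [].
- by move=> y; rewrite lee_fin; exact: cf.
- have <- := leb2_box z r0; exact: lexx.
Qed.

(** * The Euclidean norm on the plane *)

Section euclid.
Context {R : realType}.
Implicit Types x y z : R * R.

Lemma euclid_ge0 x : 0 <= euclid x.
Proof. exact: sqrtr_ge0. Qed.

Lemma sqr_euclid x : euclid x ^+ 2 = x.1 ^+ 2 + x.2 ^+ 2.
Proof. by rewrite sqr_sqrtr // addr_ge0 // sqr_ge0. Qed.

Lemma euclidD x y : euclid (x + y) <= euclid x + euclid y.
Proof.
have xy := mulr_ge0 (euclid_ge0 x) (euclid_ge0 y).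
rewrite -(@ler_pXn2r _ 2) ?nnegrE ?addr_ge0 ?euclid_ge0 //.
rewrite sqrrD !sqr_euclid /=.
have : x.1 * y.1 + x.2 * y.2 <= euclid x * euclid y.
  apply: le_trans (ler_norm _) _; rewrite -(@ler_pXn2r _ 2) ?nnegrE //.
  rewrite real_normK ?num_real // exprMn !sqr_euclid.
  (* By Lagrange's identity this square is the gap in the Cauchy-Schwarz inequality. *)
  have := sqr_ge0 (x.1 * y.2 - x.2 * y.1); nra.
lra.
Qed.

Lemma euclidZ (a : R) x : 0 <= a -> euclid (a * x.1, a * x.2) = a * euclid x.
Proof.
move=> a0; apply/eqP; rewrite -(@eqrXn2 _ 2) ?mulr_ge0 ?euclid_ge0 //.
by rewrite exprMn !sqr_euclid /=; apply/eqP; ring.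
Qed.

Lemma euclidN x : euclid (- x) = euclid x.
Proof. by rewrite /euclid /= !sqrrN. Qed.

Lemma euclidB x y : euclid (x - y) = euclid (y - x).
Proof. by rewrite -euclidN opprB. Qed.

Lemma box_euclid z (r : R) y : 0 <= r -> box z r y -> euclid (y - z) <= 2 * r.
Proof.
move=> r0 [/=]; rewrite !in_itv /= => /andP[a b] /andP[c d].
rewrite -(@ler_pXn2r _ 2) ?nnegrE ?euclid_ge0 ?mulr_ge0 // sqr_euclid /=.
nra.
Qed.

End euclid.

(** * Lower bounds for the wave kernel *)

Lemma wave_kernel_ge0 (R : realType) (s : R) (x y : R * R) :
  0 <= wave_kernel s x y.
Proof. by rewrite invr_ge0 sqrtr_ge0. Qed.

(** The strict inequality keeps [y] off the boundary circle, where the kernel is 0 by convention. *)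
Lemma wave_kernel_ge (R : realType) (s K : R) (x y : R * R) :
  euclid (x - y) < s -> s ^+ 2 - euclid (x - y) ^+ 2 <= K ->
  (Num.sqrt K)^-1 <= wave_kernel s x y.
Proof.
move=> xys sK; rewrite /wave_kernel.
have d0 : 0 < s ^+ 2 - euclid (x - y) ^+ 2.
  have := euclid_ge0 (x - y); nra.
by rewrite lef_pV2 ?posrE ?sqrtr_gt0 ?ler_wsqrtr // (lt_le_trans d0).
Qed.

Lemma wave_kernel_geV (R : realType) (s : R) (x y : R * R) :
  euclid (x - y) < s -> s^-1 <= wave_kernel s x y.
Proof.
move=> xys; have s0 : 0 <= s by rewrite (le_trans (euclid_ge0 _) (ltW xys)).
have := @wave_kernel_ge R s (s ^+ 2) x y xys.
by rewrite sqrtr_sqr ger0_norm //; apply; rewrite gerBl sqr_ge0.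
Qed.

Definition nonlin (R : realType) (p : R) (u : R * R * R -> R) (x : R * R)
    (t tau : R) : \bar R :=
  (\int[leb2]_(y in disc x (t - tau))
     (`|u (y, tau)| `^ p * wave_kernel (t - tau) x y)%:E)%E.

Lemma nonlin_ge0 (R : realType) (p : R) (u : R * R * R -> R) (x : R * R)
    (t tau : R) : (0 <= nonlin p u x t tau)%E.
Proof.
apply: (@integral_ge0 _ _ _ (lebesgue_measure \x lebesgue_measure)%E) => y _.
by rewrite lee_fin mulr_ge0 ?powR_ge0 ?wave_kernel_ge0.
Qed.

Lemma linear_part_ge0 (R : realType) (g : R * R -> R) (x : R * R) (t : R) :
  (forall y, 0 <= g y) ->
  (0 <= \int[leb2]_(y in disc x t) (g y * wave_kernel t x y)%:E)%E.
Proof.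
move=> g0.
apply: (@integral_ge0 _ _ _ (lebesgue_measure \x lebesgue_measure)%E) => y _.
by rewrite lee_fin mulr_ge0 ?wave_kernel_ge0.
Qed.

(** * Pointwise bounds from the integral equation *)

Section integral_eq_bounds.
Context {R : realType} {g : R * R -> R} {p eps : R} {T : \bar R}
  {u : R * R * R -> R}.

(** The Duhamel term is nonnegative and is dropped; the datum term is cut down to a box. *)
Lemma integral_eq_ge_linear (x z : R * R) (t r c : R) :
  integral_eq g p eps T u -> 0 < eps -> (forall y, 0 <= g y) ->
  slab T (x, t) -> 0 <= r -> 0 <= c -> box z r `<=` disc x t ->
  (forall y, box z r y -> c <= g y * wave_kernel t x y) ->
  eps / (2 * pi) * (c * (4 * r ^+ 2)) <= u (x, t).
Proof.
move=> ueq e0 g0 xt r0 c0 zD cg; rewrite -lee_fin (ueq _ _ xt).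
have pi0 := pi_gt0 R.
apply: (@le_trans _ _ ((eps / (2 * pi))%:E * \int[leb2]_(y in disc x t)
  (g y * wave_kernel t x y)%:E)%E); last first.
  rewrite leeDl // mule_ge0 ?lee_fin ?invr_ge0 ?mulr_ge0 ?pi_ge0 //.
  by apply: integral_ge0 => tau _; exact: nonlin_ge0.
rewrite EFinM lee_wpmul2l ?lee_fin ?divr_ge0 ?mulr_ge0 ?pi_ge0 ?(ltW e0) //.
apply: (leb2_integral_ge_cst (f := fun y => g y * wave_kernel t x y) r0 c0 zD) => // y _.
by rewrite mulr_ge0 ?wave_kernel_ge0.
Qed.

Lemma integral_eq_ge_nonlin (x : R * R) (t a b c : R) :
  integral_eq g p eps T u -> 0 < eps -> (forall y, 0 <= g y) ->
  slab T (x, t) -> 0 <= a -> a <= b -> b <= t -> 0 <= c ->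
  (forall tau, a <= tau -> tau <= b -> (c%:E <= nonlin p u x t tau)%E) ->
  (2 * pi)^-1 * (c * (b - a)) <= u (x, t).
Proof.
move=> ueq e0 g0 xt a0 ab bt c0 cu; rewrite -lee_fin (ueq _ _ xt).
have pi0 := pi_gt0 R.
apply: (@le_trans _ _ ((2 * pi)^-1%:E * \int[lebesgue_measure]_(tau in `[0%R, t])
  nonlin p u x t tau)%E); last first.
  rewrite leeDr // mule_ge0 ?lee_fin ?divr_ge0 ?mulr_ge0 ?pi_ge0 ?(ltW e0) //.
  exact: linear_part_ge0.
rewrite EFinM lee_wpmul2l ?lee_fin ?invr_ge0 ?mulr_ge0 ?pi_ge0 //.
apply: (@integral_ge_cst _ _ R lebesgue_measure `[a, b]%classic `[0, t]%classic
  (nonlin p u x t)) => //.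
- by move=> tau; rewrite /= !in_itv /=; lra.
- by move=> tau _; exact: nonlin_ge0.
- by move=> tau /=; rewrite in_itv /= => /andP[]; exact: cu.
- have <- := lebesgue_itvcc ab; exact: lexx.
Qed.

(** For [y] in the box, |x| - rho <= |x - y| < t, and rho <= (t - |x|) / 2. Hence t - |x - y| <= 3/2
    (t - |x|) and t + |x - y| <= 2 t, whose product bounds the radicand of the kernel. *)
Lemma linear_lower_bound (x z : R * R) (t r rho delta : R) :
  integral_eq g p eps T u -> 0 < eps -> (forall y, 0 <= g y) ->
  0 < rho -> 0 <= r -> 0 <= delta ->
  (forall y, box z r y -> euclid y <= rho /\ delta <= g y) ->
  slab T (x, t) -> euclid x + 2 * rho <= t ->
  eps / (2 * pi) * (delta * (Num.sqrt (3 * (t * (t - euclid x))))^-1 * (4 * r ^+ 2))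
    <= u (x, t).
Proof.
move=> ueq e0 g0 rho0 r0 d0 zr xt xrho.
have x0 := euclid_ge0 x.
have xyt y : box z r y -> euclid (x - y) < t.
  move=> /zr[y1 _]; have := euclidD x (- y); rewrite euclidN; lra.
apply: (integral_eq_ge_linear (z := z)) => //.
- by rewrite mulr_ge0 // invr_ge0 sqrtr_ge0.
- by move=> y /xyt /ltW.
move=> y zy; apply: ler_pM => //.
- by case: (zr y zy).
apply: wave_kernel_ge; first exact: xyt.
have [y1 _] := zr y zy.
have := xyt y zy.
have := euclidD (x - y) y; rewrite subrK.
have := euclid_ge0 (x - y).
move: (euclid (x - y)) => q; nra.
Qed.

(* The ball of radius (t - tau) / 4 about [(1 - 3 (t - tau) / (2 t)) x] lies in
   both the backward light cone of (x, t) and the cone [|y| <= tau / 2]. *)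
Lemma nonlin_lower_bound (x : R * R) (t h m : R) :
  integral_eq g p eps T u -> 0 < eps -> (forall y, 0 <= g y) -> 0 <= p ->
  slab T (x, t) -> euclid x <= t / 2 -> 0 < h -> h <= t / 2 -> 0 <= m ->
  (forall y tau, t - h <= tau -> tau < t -> euclid y <= tau / 2 ->
     m <= u (y, tau)) ->
  (512 * pi)^-1 * h ^+ 2 * m `^ p <= u (x, t).
Proof.
move=> ueq e0 g0 p0 xt x2 h0 ht m0 mu.
(* The time window is [t - h, t - h / 2]. With s = t - tau >= h / 2, a box of area s^2 / 64 and a
   kernel of at least 1 / s give s / 64 >= h / 128; the window length h / 2 and the prefactor 1 / (2
   pi) complete the constant. *)
have -> : (512 * pi)^-1 * h ^+ 2 * m `^ p =
    (2 * pi)^-1 * (m `^ p * h / 128 * (t - h / 2 - (t - h))).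
  by move: (pi : R) (pi_gt0 R) => P /lt0r_neq0 P0; field.
have mp0 : 0 <= m `^ p by exact: powR_ge0.
apply: integral_eq_ge_nonlin => //; [lra|lra|lra| |].
  by rewrite divr_ge0 // mulr_ge0 // ltW.
move=> tau tau1 tau2.
pose s := t - tau.
have s1 : h / 2 <= s by rewrite /s; lra.
have s2 : s <= h by rewrite /s; lra.
have s0 : 0 < s by lra.
have t0 : 0 < t by lra.
pose a := 3 / 2 * s / t.
have a0 : 0 <= a by rewrite /a divr_ge0 ?mulr_ge0 ?divr_ge0 // ltW.
have at3 : a * t = 3 / 2 * s by rewrite /a divfK ?gt_eqF.
have a1 : a <= 1 by rewrite -(ler_pM2r t0) at3; lra.
pose z := ((1 - a) * x.1, (1 - a) * x.2).
have ax : a * euclid x <= 3 / 4 * s by nra.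
have zE : euclid z <= tau / 2 - s / 4.
  rewrite euclidZ ?subr_ge0 // /s; rewrite /s in at3 ax *; nra.
have xz : euclid (x - z) <= 3 / 4 * s.
  have -> : x - z = (a * x.1, a * x.2).
    by apply: injective_projections => /=; ring.
  by rewrite euclidZ.
(* Points of the box are within s / 8 of [z], below the margin s / 4 left by [xz] and [zE], so |x -
   y| stays strictly under s. *)
have in_cone y : box z (s / 16) y -> euclid (x - y) < s /\ euclid y <= tau / 2.
  have s16 : 0 <= s / 16 by lra.
  move=> /(box_euclid s16) yz.
  have := euclidD (x - z) (z - y); rewrite addrA subrK (euclidB z).
  have := euclidD (y - z) z; rewrite subrK; lra.
apply: (@le_trans _ _ (m `^ p * s^-1 * (4 * (s / 16) ^+ 2))%:E).
  rewrite lee_fin (_ : m `^ p * s^-1 * _ = m `^ p * (s / 64)); last first.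
    by field; rewrite gt_eqF.
  by rewrite -mulrA ler_wpM2l //; lra.
apply: (leb2_integral_ge_cst (z := z)
  (f := fun y => `|u (y, tau)| `^ p * wave_kernel (t - tau) x y)).
- by lra.
- by rewrite mulr_ge0 // invr_ge0 ltW.
- by move=> y /in_cone[/ltW].
- by move=> y _; rewrite mulr_ge0 ?powR_ge0 ?wave_kernel_ge0.
move=> y /in_cone[xy y2]; apply: ler_pM => //.
- by rewrite invr_ge0 ltW.
- have my : m <= u (y, tau) by apply: mu => //; lra.
  rewrite ge0_ler_powR ?nnegrE //.
  by rewrite (le_trans my) // ler_norm.
- exact: wave_kernel_geV.
Qed.

End integral_eq_bounds.

(** * A logarithmic integral over a disc *)

Lemma is_derive_lnsub (R : realType) (c y : R) : y < c -> is_derive y 1 (fun z => - ln (c - z)) (c - y)^-1.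
Proof.
move=> yc.
have c0 : 0 < c - y by rewrite subr_gt0.
have := is_derive1_ln c0 => dl.
have dc : is_derive y 1 (fun z => c - z) (-1).
  have := is_deriveB (is_derive_cst c y 1) (is_derive_id y 1).
  by rewrite sub0r.
have := @is_derive1_comp R (@ln R) (fun z => c - z) y _ _ dl dc => dd.
have -> : (c - y)^-1 = - ((c - y)^-1 * -1) by rewrite mulrN1 opprK.
exact: (is_deriveN dd).
Qed.

Lemma integral_inv_sub (R : realType) (a b : R) : 0 < a -> 0 < b ->
  (\int[lebesgue_measure]_(y in `[0%R, b]) ((a + b - y)^-1)%:E = (ln (1 + b / a))%:E)%E.
Proof.
move=> a0 b0.
have ab0 : 0 < a + b by rewrite addr_gt0.
have dF (y : R) : y <= b -> is_derive y 1 (fun z => - ln (a + b - z)) (a + b - y)^-1.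
  by move=> yb; apply: is_derive_lnsub; lra.
have cF (y : R) : y <= b -> {for y, continuous (fun z => - ln (a + b - z))}.
  by move=> /dF dy; apply: differentiable_continuous; apply/derivable1_diffP.
rewrite (@continuous_FTC2 _ _ (fun z => - ln (a + b - z)) 0 b b0).
- rewrite -EFinB; congr EFin.
  rewrite subr0 addrK opprK addrC -ln_div ?posrE //.
  by congr ln; rewrite mulrDl divff ?gt_eqF.
- apply/continuous_in_subspaceT => y; rewrite inE /= in_itv /= => /andP[_ yb].
  apply: cvgV; first by rewrite gt_eqF //; lra.
  by apply: cvgB; [exact: cvg_cst|exact: cvg_id].
- split.
  + by move=> y; rewrite in_itv /= => /andP[_ yb]; have [] := dF y (ltW yb).
  + exact: cvg_at_right_filter (cF 0 (ltW b0)).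
  + exact: cvg_at_left_filter (cF b (lexx b)).
- by move=> y; rewrite in_itv /= => /andP[_ yb]; rewrite derive1E; have [_ ->] := dF y (ltW yb).
Qed.

(* On vertical segments [0 <= y.2 <= b] below the circle of radius r, the
   triangle inequality gives [r - |y| <= b - y.2]; the inner integral is then
   an explicit logarithm. *)
Lemma integral_disc_log (R : realType) (r rho : R) : 0 < r -> 0 < rho ->
  ((r * ln (1 + r / (4 * rho)))%:E <=
    \int[leb2]_(y in [set y | (euclid y <= r)%R])
      ((2 * rho + r - euclid y)^-1)%:E)%E.
Proof.
move=> r0 rho0.
pose b (s : R) := Num.sqrt (r ^+ 2 - s ^+ 2).
have mb : measurable_fun [set: R] b.
  apply: continuous_measurable_fun => s.
  apply: continuous_comp; last exact: sqrt_continuous.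
  by apply: cvgB; [exact: cvg_cst|exact: exprn_continuous].
pose B : set (R * R) := `[- (r / 2), r / 2] `*` `[0, +oo[.
pose A : set (R * R) := B `&` [set y | y.2 <= b y.1].
have mbf : measurable_fun [set: R * R] (b \o fst) by apply: measurableT_comp.
have mA : measurable A.
  apply: measurable_fun_le.
  - by apply: measurableX; exact: measurable_itv.
  - exact: measurable_funS measurable_snd.
  - exact: measurable_funS mbf.
(* As a power, [f] is measurable on the whole plane by [measurable_powR]; on [A] the base is
   positive and the power is the inverse. *)
pose f (y : R * R) := ((2 * rho + b y.1 - y.2) `^ (-1))%:E.
pose fA : R * R -> \bar R := f \_ A.
have mf : measurable_fun [set: R * R] fA.
  apply/(measurable_restrictT _ mA).
  apply: measurable_funS (_ : measurable_fun [set: R * R] f) => //.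
  apply/measurable_EFinP.
  apply: (@measurableT_comp _ _ _ _ _ _ (fun x : R => x `^ (-1))).
    exact: measurable_powR.
  apply: measurable_funB => //; apply: measurable_funD => //.
have f0 y : (0 <= f y)%E by rewrite lee_fin powR_ge0.
(* Over the middle half of the diameter every vertical segment has length at least r / 2, which
   produces the uniform logarithm with argument 1 + r / (4 rho). *)
have bE s : `|s| <= r / 2 -> r / 2 <= b s /\ b s ^+ 2 = r ^+ 2 - s ^+ 2.
  move=> sr; have s2 : s ^+ 2 <= (r / 2) ^+ 2.
    by rewrite -real_normK ?num_real // ler_pXn2r ?nnegrE //; lra.
  split; last by rewrite sqr_sqrtr; nra.
  rewrite -[leLHS](@ger0_norm _ (r / 2)); last lra.
  by rewrite -sqrtr_sqr ler_wsqrtr; nra.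
have AE y : A y <-> [/\ `|y.1| <= r / 2, 0 <= y.2 & y.2 <= b y.1].
  by rewrite /A /B /= !in_itv /= andbT ler_norml; split=> [[[]]|[]].
apply: (@le_trans _ _ (\int[leb2]_(y in A) f y)%E); last first.
  apply: (@le_integral_subset _ _ _ (lebesgue_measure \x lebesgue_measure)%E) => //.
  - move=> y /AE[y1 y20 y2b] /=; have [b1 b2] := bE _ y1.
    rewrite -(@ler_pXn2r _ 2) ?nnegrE ?euclid_ge0 ?(ltW r0) // sqr_euclid; nra.
  - by move=> y /= yr; rewrite lee_fin invr_ge0; lra.
  - move=> y /AE[y1 y20 y2b]; have [b1 b2] := bE _ y1.
    rewrite lee_fin powR_inv1; last lra.
    have yr : r <= euclid y + (b y.1 - y.2).
      have bE' : euclid (y.1, b y.1) = r.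
        by rewrite /euclid /= b2 addrC subrK sqrtr_sqr gtr0_norm.
      have := euclidD y (0, b y.1 - y.2).
      rewrite (_ : y + _ = (y.1, b y.1)); last first.
        by apply: injective_projections => /=; ring.
      rewrite bE' => /le_trans; apply; rewrite lerD2l.
      rewrite /euclid /= expr0n add0r sqrtr_sqr ger0_norm //; lra.
    have ey : euclid y <= r.
      rewrite -(@ler_pXn2r _ 2) ?nnegrE ?euclid_ge0 ?(ltW r0) // sqr_euclid; nra.
    rewrite lef_pV2 ?posrE; lra.
rewrite integral_mkcond.
have -> : (\int[leb2]_y (f \_ A) y = \int[lebesgue_measure]_s
    \int[lebesgue_measure]_w (f \_ A) (s, w))%E.
  by apply: fubini_tonelli1 => // y; exact: erestrict_ge0.
(* The base of the region has length r, which supplies the factor in front of the logarithm. *)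
rewrite mulrC.
apply: (@integral_ge_cst _ _ R lebesgue_measure `[- (r / 2), r / 2]%classic) => //.
- by move=> s _; apply: integral_ge0 => w _; exact: erestrict_ge0.
- by apply: ln_ge0; rewrite lerDl divr_ge0 // ?mulr_ge0 ?ltW.
- move=> s; rewrite /= in_itv /= -ler_norml => sr.
  have [b1 b2] := bE _ sr.
  have bs0 : 0 < b s by lra.
  have rho2 : 0 < 2 * rho by lra.
  apply: (@le_trans _ _ (ln (1 + b s / (2 * rho)))%:E).
    have q0 : 0 <= r / (4 * rho) by rewrite divr_ge0 ?mulr_ge0 ?ltW.
    have q1 : r / (4 * rho) <= b s / (2 * rho).
      rewrite ler_pdivlMr // mulrAC ler_pdivrMr ?mulr_gt0 //; nra.
    by rewrite lee_fin ler_ln ?posrE; lra.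
  rewrite -(integral_inv_sub rho2 bs0).
  apply: (@le_integral_subset _ _ R lebesgue_measure) => //.
  - by move=> w; rewrite /= in_itv /= => /andP[w0 wb]; rewrite lee_fin invr_ge0; lra.
  - by move=> w _; exact: erestrict_ge0.
  - move=> w; rewrite /= in_itv /= => /andP[w0 wb].
    rewrite patchE mem_set /f /=; last by apply/AE.
    by rewrite powR_inv1 //; lra.
- have -> : r%:E = (r / 2 - (- (r / 2)))%:E by congr EFin; field.
  have <- := @lebesgue_itvcc R (- (r / 2)) (r / 2); first exact: lexx.
  by lra.
Qed.

(** * Blow-up by iteration *)

Lemma bernoulli_ineq (R : realType) (d : R) (k : nat) :
  0 <= d -> 1 + k%:R * d <= (1 + d) ^+ k.
Proof.
move=> d0; elim: k => [|k IH]; first by rewrite mul0r addr0 expr0.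
rewrite exprS -natr1; have := ler0n R k; move: (k%:R) IH => n IH n0.
apply: (@le_trans _ _ ((1 + d) * (1 + n * d))); first by nra.
by rewrite ler_wpM2l //; lra.
Qed.

Lemma exprn_unbounded (R : realType) (lam M : R) :
  1 < lam -> exists k : nat, M < lam ^+ k.
Proof.
move=> l1; have d0 : 0 < lam - 1 by lra.
exists (Num.truncn (M / (lam - 1))).+1.
have := bernoulli_ineq (Num.truncn (M / (lam - 1))).+1 (ltW d0).
rewrite [1 + (lam - 1)]addrC subrK; apply: lt_le_trans.
apply: ltr_pwDl => //; rewrite -ler_pdivrMr //.
exact/ltW/truncnS_gt.
Qed.

(* On [S (2 - 2 ^- k), 2 S] the k-th iterate of the local growth estimate gives
   u >= m lam ^ k; the steps S / 2 ^ k.+1 are summable, so the iteration never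
   leaves the lifespan. *)
Lemma blow_up (R : realType) (g : R * R -> R) (p eps : R) (T : \bar R)
    (u : R * R * R -> R) (S m : R) (lam := 4 `^ (p - 1)^-1) :
  integral_eq g p eps T u -> 0 < eps -> (forall y, 0 <= g y) -> 1 < p ->
  0 < S -> 0 < m -> ((2 * S)%:E < T)%E ->
  (forall x t, S <= t -> t <= 2 * S -> euclid x <= t / 2 -> m <= u (x, t)) ->
  4 * lam <= (512 * pi)^-1 * S ^+ 2 * m `^ (p - 1) -> False.
Proof.
move=> ueq e0 g0 p1 S0 m0 ST um big.
have q0 : 0 < p - 1 by lra.
(* The value 4 is the factor by which h^2 shrinks when the step h is halved. *)
have lamq : lam `^ (p - 1) = 4 by rewrite -powRrM mulVf ?gt_eqF // powRr1.
have lam0 : 0 < lam by rewrite powR_gt0.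
have lam1 : 1 < lam.
  rewrite ltNge; apply/negP => l1.
  have : lam `^ (p - 1) <= 1 `^ (p - 1).
    by rewrite ge0_ler_powR ?nnegrE //; lra.
  by rewrite lamq powR1; lra.
have growth k : forall x t, 2 * S - S / 2 ^+ k <= t -> t <= 2 * S ->
    euclid x <= t / 2 -> m * lam ^+ k <= u (x, t).
  elim: k => [x t|k IH x t].
    by rewrite !expr0 mulr1 divr1 => ? ? ?; apply: um => //; lra.
  have h0 : 0 < S / 2 ^+ k.+1 by rewrite divr_gt0 // exprn_gt0.
  (* The new step is half of the previous distance to 2 S, so [t - h, t) stays in the time range of
     [IH]. *)
  have hS : S / 2 ^+ k = 2 * (S / 2 ^+ k.+1).
    have z0 : 2 ^+ k != 0 :> R by rewrite expf_neq0.
    by rewrite exprS; move: (2 ^+ k) z0 => z z0; field.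
  have h1 : S / 2 ^+ k.+1 <= S / 2.
    rewrite ler_pM2l // lef_pV2 ?posrE ?exprn_gt0 // exprS.
    by rewrite ler_peMr // exprn_ege1 //; lra.
  set h := S / 2 ^+ k.+1 in h0 hS h1 *.
  move=> t1 t2 xt.
  have mk0 : 0 < m * lam ^+ k by rewrite mulr_gt0 // exprn_gt0.
  have := @nonlin_lower_bound R g p eps T u x t h (m * lam ^+ k).
  move=> /(_ ueq e0 g0) /(_ ltac:(lra)) step.
  (* The factor 4^k from the power p - 1 of lam^k cancels the decay of h^2 and leaves S^2 / 4; [big]
     then yields one more factor [lam]. *)
  have grow : m * lam ^+ k.+1 <= (512 * pi)^-1 * h ^+ 2 * (m * lam ^+ k) `^ p.
    rewrite -(subrK 1 p) powRD; last by rewrite (gt_eqF mk0) implybT.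
    rewrite powRr1 ?(ltW mk0) // powRM ?(ltW m0) ?(ltW (exprn_gt0 k lam0)) //.
    have -> : (lam ^+ k) `^ (p - 1) = 4 ^+ k.
      rewrite -!powR_mulrn ?(ltW lam0) // -powRrM mulrC powRrM lamq powR_mulrn //.
    have hE : h ^+ 2 * 4 ^+ k = S ^+ 2 / 4.
      have z0 : 4 ^+ k != 0 :> R by rewrite expf_neq0.
      rewrite /h expr_div_n -exprM mulnC exprM (_ : 2 ^+ 2 = 4 :> R); last by ring.
      by rewrite (exprS 4 k); move: (4 ^+ k) z0 => z z0; field.
    have -> : (512 * pi)^-1 * h ^+ 2 * (m `^ (p - 1) * 4 ^+ k * (m * lam ^+ k)) =
        (512 * pi)^-1 * (h ^+ 2 * 4 ^+ k) * m `^ (p - 1) * (m * lam ^+ k).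
      by ring.
    by rewrite hE exprSr mulrA [leLHS]mulrC ler_wpM2r ?(ltW mk0) //; lra.
  apply: (le_trans grow); apply: step => //.
  - by split; [rewrite /=; lra|rewrite (le_lt_trans _ ST) // lee_fin].
  - by lra.
  - exact: ltW.
  - by move=> y tau tau1 tau2 ytau; apply: IH => //; lra.
(* At the origin at time 2 S all the bounds m lam^k hold at once, which is impossible for a real
   value. *)
have [k] := exprn_unbounded (u ((0, 0), 2 * S) / m) lam1.
rewrite ltNge ler_pdivlMr // mulrC growth // /euclid /=.
- by rewrite gerBl divr_ge0 ?ltW ?exprn_gt0.
- by rewrite expr0n /= addr0 sqrtr0; lra.
Qed.

(** * The logarithmic improvement for p = 2 *)

Lemma measurable_euclid (R : realType) : measurable_fun [set: R * R] (@euclid R).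
Proof.
apply: (@measurableT_comp _ _ _ _ _ _ (@Num.sqrt R)).
  by apply: continuous_measurable_fun; exact: sqrt_continuous.
by apply: measurable_funD; apply: measurable_funX;
  [exact: measurable_fst|exact: measurable_snd].
Qed.

Lemma integral_disc_logZ (R : realType) (r rho k : R) : 0 < r -> 0 < rho ->
  0 <= k ->
  ((k * (r * ln (1 + r / (4 * rho))))%:E <=
    \int[leb2]_(y in [set y | (euclid y <= r)%R])
      (k * (2 * rho + r - euclid y)^-1)%:E)%E.
Proof.
move=> r0 rho0 k0.
have mE := @measurable_euclid R.
have mD : measurable [set y : R * R | euclid y <= r].
  rewrite -[X in measurable X]setTI.
  by apply: measurable_fun_le => //; exact: measurable_cst.
have := integral_disc_log r0 rho0.
rewrite /leb2; under [in X in _ -> X]eq_integral do rewrite EFinM.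
rewrite ge0_integralZl ?lee_fin //.
- by move=> h; rewrite EFinM lee_wpmul2l.
- apply/measurable_EFinP.
  apply: (eq_measurable_fun (fun y => (2 * rho + r - euclid y) `^ (-1))).
    by move=> y; rewrite inE /= => yr; rewrite powR_inv1 //; lra.
  apply: measurable_funTS.
  apply: (@measurableT_comp _ _ _ _ _ _ (fun w : R => w `^ (-1))).
    exact: measurable_powR.
  by apply: measurable_funB.
- by move=> y /= yr; rewrite lee_fin invr_ge0; lra.
Qed.

(** For tau in [t / 8, t / 4] the disc |y| <= tau - 2 rho lies in the backward cone of (x, t) and
    the kernel is at least 1 / (t - tau). The squared linear bound is k^2 / (tau (tau - |y|)), and
    tau (t - tau) <= t^2 reduces the integral to [integral_disc_logZ]. The constant is 256 = 2 * 16
    * 8. *)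
Lemma log_lower_bound (R : realType) (g : R * R -> R) (eps : R)
    (T : \bar R) (u : R * R * R -> R) (rho k : R) (x : R * R) (t : R) :
  integral_eq g 2 eps T u -> 0 < eps -> (forall y, 0 <= g y) ->
  0 < rho -> 0 <= k ->
  (forall y tau, slab T (y, tau) -> euclid y + 2 * rho <= tau ->
    k / Num.sqrt (tau * (tau - euclid y)) <= u (y, tau)) ->
  slab T (x, t) -> euclid x <= t / 2 -> 32 * rho <= t ->
  (256 * pi)^-1 * k ^+ 2 * ln (1 + t / (64 * rho)) <= u (x, t).
Proof.
move=> ueq e0 g0 rho0 k0 lin xt x2 t32.
have t0 : 0 < t by lra.
have -> : (256 * pi)^-1 * k ^+ 2 * ln (1 + t / (64 * rho)) =
    (2 * pi)^-1 * (k ^+ 2 / t ^+ 2 * (t / 16 * ln (1 + t / (64 * rho))) *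
      (t / 4 - t / 8)).
  move: (ln _) => L.
  have tN0 := lt0r_neq0 t0.
  by move: (pi : R) (pi_gt0 R) => P /lt0r_neq0 P0; field; rewrite tN0 P0.
have L0 : 0 <= ln (1 + t / (64 * rho)).
  by apply: ln_ge0; rewrite lerDl divr_ge0 ?mulr_ge0 ?ltW.
have k2 : 0 <= k ^+ 2 / t ^+ 2 by rewrite divr_ge0 ?sqr_ge0.
apply: (integral_eq_ge_nonlin ueq e0 g0 xt); [lra|lra|lra| |].
  by rewrite mulr_ge0 // mulr_ge0 // divr_ge0 // ltW.
move=> tau tau1 tau2.
(* With this radius 2 rho + r - |y| is tau - |y|, the singular factor in [lin]; [32 * rho <= t]
   ensures r >= t / 16. *)
pose r := tau - 2 * rho.
have r16 : t / 16 <= r by rewrite /r; lra.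
have r0 : 0 < r by lra.
apply: (@le_trans _ _ (k ^+ 2 / t ^+ 2 * (r * ln (1 + r / (4 * rho))))%:E).
  rewrite lee_fin ler_wpM2l //; apply: ler_pM => //; first by lra.
  have rr : t / (64 * rho) <= r / (4 * rho).
    rewrite ler_pdivlMr ?mulr_gt0 // mulrAC ler_pdivrMr ?mulr_gt0 //; nra.
  have tr0 : 0 < t / (64 * rho) by rewrite divr_gt0 ?mulr_gt0.
  by rewrite ler_ln ?posrE; lra.
apply: (le_trans (integral_disc_logZ r0 rho0 k2)).
apply: (@le_integral_subset _ _ _ (lebesgue_measure \x lebesgue_measure)%E).
- move=> y /= yr; have := euclidD x (- y); rewrite euclidN /disc /=; rewrite /r in yr; lra.
- by move=> y /= yr; rewrite lee_fin mulr_ge0 // invr_ge0; lra.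
- by move=> y _; rewrite lee_fin mulr_ge0 ?powR_ge0 ?wave_kernel_ge0.
move=> y /= yr; rewrite lee_fin.
have y0 := euclid_ge0 y.
have w0 : 0 < 2 * rho + r - euclid y by lra.
have tauE : tau - euclid y = 2 * rho + r - euclid y by rewrite /r; ring.
have tau0 : 0 < tau by lra.
have yT : slab T (y, tau).
  case: xt => /= _ tT; split; first by rewrite /= ltW.
  by rewrite /= (le_lt_trans _ tT) // lee_fin; lra.
have := lin y tau yT ltac:(rewrite /r in yr; lra); rewrite tauE.
set w := 2 * rho + r - euclid y in w0 *.
move=> uy.
have xy : euclid (x - y) < t - tau.
  have := euclidD x (- y); rewrite euclidN; rewrite /r in yr; lra.
apply: (@le_trans _ _ ((k ^+ 2 / (tau * w)) * (t - tau)^-1)).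
  move: (k ^+ 2) (sqr_ge0 k) => K K0.
  rewrite -!mulrA ler_wpM2l // -!invfM lef_pV2 ?posrE ?mulr_gt0 ?exprn_gt0 //; last by lra.
  have tt : tau * (t - tau) <= t ^+ 2 by nra.
  by have := ler_wpM2r (ltW w0) tt; lra.
apply: ler_pM; last exact: wave_kernel_geV.
- by rewrite divr_ge0 ?sqr_ge0 // mulr_ge0 // ltW.
- by rewrite invr_ge0; lra.
rewrite powR_mulrn ?normr_ge0 // real_normK ?num_real //.
have -> : k ^+ 2 / (tau * w) = (k / Num.sqrt (tau * w)) ^+ 2.
  by rewrite expr_div_n sqr_sqrtr // mulr_ge0 // ltW.
have q0 : 0 <= k / Num.sqrt (tau * w) by rewrite divr_ge0 ?sqrtr_ge0.
by rewrite ler_pXn2r ?nnegrE // (le_trans q0).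
Qed.

(** * Positivity of the datum and size of a *)

Lemma continuous_box_lower_bound (R : realType) (g : R * R -> R) (z : R * R) :
  {for z, continuous g} -> 0 < g z ->
  exists2 r, 0 < r & forall y, box z r y -> g z / 2 <= g y.
Proof.
move=> gz g0.
have : \forall y \near z, g z / 2 < g y by apply: (cvgr_gt (g z) gz); lra.
move=> /nbhs_ballP[r /= r0 zr]; exists (r / 2); first by rewrite divr_gt0.
move=> y [/=]; rewrite !in_itv /= => /andP[a b] /andP[c d].
by apply/ltW/zr; split; rewrite /= /ball /= ltr_norml; apply/andP; split; lra.
Qed.

(** If a < 1, then a^2 eps^2 <= 1 and log (1 + a) <= a < 1, so the defining product is below 1. *)
Lemma is_a_ge1 (R : realType) (eps a : R) :
  0 < eps -> eps <= 1 -> is_a eps a -> 1 <= a.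
Proof.
move=> e0 e1 [a0 ha]; rewrite leNgt; apply/negP => a1.
have ln0 : 0 <= ln (1 + a) by rewrite ln_ge0 // lerDl ltW.
have lna : ln (1 + a) <= a by rewrite le_ln1Dx //; lra.
have ea : a ^+ 2 * eps ^+ 2 <= 1 by rewrite -exprMn exprn_ile1 //; nra.
have := ler_wpM2r ln0 ea; lra.
Qed.

(** * Upper bounds for the existence time *)

Section blow_up_time.
Context {R : realType} {g : R * R -> R} {p eps : R} {T : \bar R}
  {u : R * R * R -> R} {rho k : R}.

(** The estimate of [linear_lower_bound], with its constants gathered in [k] and the dependence on
    [eps] kept explicit. *)
Definition linear_bound : Prop := forall y tau, slab T (y, tau) ->
  euclid y + 2 * rho <= tau ->
  k * eps / Num.sqrt (tau * (tau - euclid y)) <= u (y, tau).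

(** Take 2 S equal to the claimed bound and m = k eps / (2 S). Then S^2 m^(p-1) is a constant times
    eps^(p-1) S^(3-p), and the exponent of eps in S is the one that cancels eps^(p-1). *)
Lemma subcritical_blow_up_time (C : R) :
  integral_eq g p eps T u -> 0 < eps -> eps <= 1 -> (forall y, 0 <= g y) ->
  0 < rho -> 0 < k -> linear_bound -> 1 < p -> p < 2 ->
  2 <= C -> 8 * rho <= C ->
  4 * 4 `^ (p - 1)^-1 <= (512 * pi)^-1 * (k / 2) `^ (p - 1) * (C / 2) ->
  (T <= (C * eps `^ (- ((p - 1) / (3 - p))))%:E)%E.
Proof.
move=> ueq e0 e1 g0 rho0 k0 lin p1 p2 C2 C8 big.
set e := eps `^ _.
have e_ge1 : 1 <= e.
  rewrite /e powRN invf_ge1 ?powR_gt0 //.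
  have := @ge0_ler_powR R ((p - 1) / (3 - p)) _ eps 1.
  rewrite powR1 !nnegrE; apply => //; first by rewrite divr_ge0; lra.
  exact: ltW.
rewrite leNgt; apply/negP => eT.
pose S := C * e / 2.
(* For t >= S and |x| <= t / 2 this gives |x| + 2 rho <= t, the domain of [lin]. *)
have S4 : 4 * rho <= S by rewrite /S; nra.
have S0 : 0 < S by lra.
have m0 : 0 < k * eps / (2 * S) by rewrite divr_gt0 // mulr_gt0.
have ST : ((2 * S)%:E < T)%E.
  by rewrite (_ : 2 * S = C * e) //; rewrite /S; field.
apply: (blow_up ueq e0 g0 p1 S0 m0 ST).
  move=> x t t1 t2 xt; have x0 := euclid_ge0 x.
  apply: le_trans (lin x t _ _); last 2 first.
  - split; first by rewrite /=; lra.
    by rewrite /= (le_lt_trans _ ST) // lee_fin.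
  - by lra.
  rewrite ler_wpM2l ?(ltW (mulr_gt0 k0 e0)) //.
  have tx : 0 < t * (t - euclid x) by nra.
  rewrite lef_pV2 ?posrE ?sqrtr_gt0 //; last by lra.
  apply: (@le_trans _ _ (Num.sqrt (t ^+ 2))); first by rewrite ler_wsqrtr; nra.
  by rewrite sqrtr_sqr ger0_norm; lra.
have -> : k * eps / (2 * S) = (k / 2) * (eps / S) by rewrite invfM; ring.
apply: (le_trans big); rewrite -2!mulrA ler_wpM2l ?invr_ge0 ?mulr_ge0 ?pi_ge0 //.
have k20 : 0 <= k / 2 by rewrite divr_ge0 // ltW.
have eS0 : 0 <= eps / S by rewrite divr_ge0 // ltW.
rewrite (powRM _ k20 eS0) [leRHS]mulrCA ler_wpM2l ?powR_ge0 //.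
have -> : (eps / S) `^ (p - 1) = eps `^ (p - 1) * S `^ (- (p - 1)).
  by rewrite powRM ?invr_ge0 ?(ltW e0) ?(ltW S0) // -powR_inv1 ?(ltW S0) // -powRrM mulN1r.
rewrite [leRHS]mulrCA -(powR_mulrn 2 (ltW S0)). rewrite -powRD; last by rewrite (gt_eqF S0) implybT.
rewrite (_ : 2%:R + - (p - 1) = 3 - p); last by ring.
have -> : S = C / 2 * e by rewrite /S; ring.
have C20 : 1 <= C / 2 by lra.
rewrite powRM ?(le_trans ler01) // /e -powRrM.
have -> : - ((p - 1) / (3 - p)) * (3 - p) = - (p - 1).
  by rewrite mulNr divfK //; lra.
rewrite [leRHS]mulrCA -powRD; last by rewrite (gt_eqF e0) implybT.
(* The powers of eps are gone; C / 2 >= 1 and 3 - p >= 1 give C / 2 <= (C / 2)^(3-p). *)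
rewrite subrr powRr0 mulr1 -[leLHS]powRr1 ?(le_trans ler01) //.
by rewrite ler_powR //; lra.
Qed.

(** With S = C a / 2 and m a constant times eps^2 log (1 + a), the quantity S^2 m is a constant
    times a^2 eps^2 log (1 + a), which is 1 by definition of a. *)
Lemma critical_blow_up_time (C : R) :
  integral_eq g 2 eps T u -> 0 < eps -> eps <= 1 -> (forall y, 0 <= g y) ->
  0 < rho -> 0 < k -> linear_bound -> 1 <= C -> 128 * rho <= C ->
  4 * 4 `^ (2 - 1)^-1 <=
    (512 * pi)^-1 * ((256 * pi)^-1 * k ^+ 2) * (C / 4) ->
  (T <= (C * a_of eps)%:E)%E.
Proof.
move=> ueq e0 e1 g0 rho0 k0 lin C1 C128 big.
have aP := a_ofP e0; have a_ge1 := is_a_ge1 e0 e1 aP.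
case: aP a_ge1; set a := a_of eps => a0 ha a_ge1.
rewrite leNgt; apply/negP => aT.
pose S := C * a / 2.
have S32 : 32 * rho <= S by rewrite /S; nra.
have S0 : 0 < S by lra.
have ST : ((2 * S)%:E < T)%E.
  by rewrite (_ : 2 * S = C * a) //; rewrite /S; field.
have pi0 := pi_gt0 R.
have c0 : 0 < (256 * pi)^-1 :> R by rewrite invr_gt0 mulr_gt0.
(* From [128 * rho <= C]: at any time t >= S the logarithm of [log_lower_bound] then dominates log
   (1 + a). *)
have aS : a <= S / (64 * rho).
  have r64 : 0 < 64 * rho by lra.
  by rewrite ler_pdivlMr // /S; nra.
have l0 : 0 < ln (1 + a) by rewrite ln_gt0 // ltrDl.
have ln_le v : a <= v -> ln (1 + a) <= ln (1 + v).
  by move=> av; rewrite ler_ln ?posrE; lra.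
have m0 : 0 < (256 * pi)^-1 * (k * eps) ^+ 2 * ln (1 + a).
  by rewrite !mulr_gt0 // exprn_gt0 // mulr_gt0.
have p1 : (1 : R) < 2 by lra.
apply: (blow_up ueq e0 g0 p1 S0 m0 ST).
  move=> x t t1 t2 xt; have ke0 : 0 <= k * eps by rewrite ltW // mulr_gt0.
  have xtT : slab T (x, t).
    split; first by rewrite /=; lra.
    by rewrite /= (le_lt_trans _ ST) // lee_fin.
  apply: le_trans (log_lower_bound ueq e0 g0 rho0 ke0 lin xtT xt _); last lra.
  rewrite ler_wpM2l ?(mulr_ge0 (ltW c0) (sqr_ge0 (k * eps))) //.
  have St : S / (64 * rho) <= t / (64 * rho).
    by rewrite ler_wpM2r // invr_ge0 ltW // mulr_gt0.
  exact/ln_le/(le_trans aS).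
apply: (le_trans big).
rewrite (_ : 2 - 1 = 1) ?powRr1 ?(ltW m0) //; last by ring.
have -> : (512 * pi)^-1 * S ^+ 2 * ((256 * pi)^-1 * (k * eps) ^+ 2 * ln (1 + a)) =
    (512 * pi)^-1 * ((256 * pi)^-1 * k ^+ 2) * (C ^+ 2 / 4) *
      (a ^+ 2 * eps ^+ 2 * ln (1 + a)).
  by rewrite /S; move: (ln _) (512 * pi)^-1 (256 * pi)^-1 => L x y; field.
have CC : C / 4 <= C ^+ 2 / 4 by rewrite ler_pM2r ?invr_gt0 // expr2 ler_peMl //; lra.
rewrite ha mulr1; apply: ler_wpM2l CC.
apply: mulr_ge0; first by rewrite invr_ge0 mulr_ge0 ?pi_ge0.
exact: mulr_ge0 (ltW c0) (sqr_ge0 k).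
Qed.

End blow_up_time.

(** * Choice of the constants *)

Theorem theorem4p1 (R : realType) (p rad : R) (g : R * R -> R) :
  1 < p -> p <= 2 -> 0 < rad ->
  C1_on setT g ->
  (forall x, 0 <= g x) ->
  (exists x, g x != 0) ->
  compact (supp setT g) ->
  supp setT g `<=` [set x | euclid x <= rad] ->
  exists eps2 C : R, [/\ 0 < eps2, 0 < C &
    forall eps : R, 0 < eps -> eps <= eps2 ->
    (exists u : R * R * R -> R,
      C1_solution g p eps (lifespan g p eps) u /\
      supp (slab (lifespan g p eps)) u `<=`
        [set z | 0 <= z.2 /\ euclid z.1 <= z.2 + rad]) ->
    (p = 2 -> (lifespan g p eps <= (C * a_of eps)%:E)%E) /\
    (p < 2 ->
      (lifespan g p eps <= (C * eps `^ (- ((p - 1) / (3 - p))))%:E)%E)].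
Proof.
move=> p1 p2 rad0 [gc _ _] g0 [z gz] _ gsupp.
have {gz} gz0 : 0 < g z by rewrite lt_neqAle eq_sym gz g0.
have gcz : {for z, continuous g} by exact: (continuous_subspace_setT g).2 gc z.
have [r r0 zr] := continuous_box_lower_bound gcz gz0.
pose delta := g z / 2; have d0 : 0 < delta by rewrite divr_gt0.
have zr_rad y : box z r y -> euclid y <= rad /\ delta <= g y.
  move=> /zr gy; split => //; apply: gsupp; apply: subset_closure; split => //=.
  by rewrite gt_eqF // (lt_le_trans d0).
have pi0 := pi_gt0 R.
(* The constant of [linear_lower_bound] for a box of half-side [r] on which g >= [delta], with eps
   factored out. *)
pose k := (2 * pi)^-1 * (delta * (Num.sqrt 3)^-1 * (4 * r ^+ 2)).
have k0 : 0 < k by rewrite !mulr_gt0 ?invr_gt0 ?mulr_gt0 ?sqrtr_gt0 ?exprn_gt0.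
pose K : R := 4 * 4 `^ (p - 1)^-1.
have K0 : 0 < K by rewrite mulr_gt0 ?powR_gt0.
pose A1 := (512 * pi)^-1 * (k / 2) `^ (p - 1).
pose A2 := (512 * pi)^-1 * ((256 * pi)^-1 * k ^+ 2).
have c1 : 0 < (512 * pi)^-1 :> R.
  by rewrite invr_gt0; apply: mulr_gt0 pi0; rewrite ltr0n.
have c2 : 0 < (256 * pi)^-1 :> R by rewrite invr_gt0 mulr_gt0.
have A10 : 0 < A1 by apply: mulr_gt0 => //; rewrite powR_gt0 // divr_gt0.
have A20 : 0 < A2 by apply: mulr_gt0 => //; apply: mulr_gt0 => //; rewrite exprn_gt0.
have K1 : 0 < 2 * K / A1 by apply: divr_gt0 => //; apply: mulr_gt0.
have K2 : 0 < 4 * K / A2 by apply: divr_gt0 => //; apply: mulr_gt0.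
(* Each summand secures one requirement of the two blow-up lemmas; the last two give K <= A1 C / 2
   and K <= A2 C / 4. *)
pose C := 2 + 128 * rad + 2 * K / A1 + 4 * K / A2.
(* The bound eps <= 1 makes both a and the power of eps at least 1, so S exceeds the required
   multiples of [rad]. *)
exists 1, C; split => //; first by rewrite /C; lra.
move=> eps e0 e1 [u [[_ ueq] _]].
have lin : @linear_bound R eps (lifespan g p eps) u rad k.
  move=> y tau ytau yrad.
  have := linear_lower_bound ueq e0 g0 rad0 (ltW r0) (ltW d0) zr_rad ytau yrad.
  rewrite sqrtrM // (invfM (Num.sqrt 3)) /k; apply: le_trans.
  rewrite le_eqVlt; apply/orP; left; apply/eqP.
  by move: (Num.sqrt _)^-1 (Num.sqrt _)^-1 (2 * pi)^-1 => a b c; ring.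
have CK1 : K <= A1 * (C / 2).
  by rewrite mulrC -ler_pdivrMr // ler_pdivlMr // mulrC mulrA /C; lra.
have CK2 : K <= A2 * (C / 4).
  by rewrite mulrC -ler_pdivrMr // ler_pdivlMr // mulrC mulrA /C; lra.
have C2 : 2 <= C by rewrite /C; lra.
have C128 : 128 * rad <= C by rewrite /C; lra.
split=> [p2E|plt2].
  have CK2' : 4 * 4 `^ (2 - 1)^-1 <= A2 * (C / 4) by move: CK2; rewrite /K p2E.
  have ueq2 : integral_eq g 2 eps (lifespan g p eps) u by move: ueq; rewrite p2E.
  have C1 : 1 <= C by lra.
  exact: (critical_blow_up_time ueq2 e0 e1 g0 rad0 k0 lin C1 C128 CK2').
have C8 : 8 * rad <= C by lra.
exact: (subcritical_blow_up_time ueq e0 e1 g0 rad0 k0 lin p1 plt2 C2 C8 CK1).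
Qed.
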